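(* Let $A, B, C, C'\in \widehat{\mathbb{F}_q^{\times}}$. For $x, y\in \mathbb{F}_q$ such that $x, y\neq 1$ we have $$\overline{A}(1-x)\,\overline{B}(1-y)\,F_{4}\left(A;B;C,C';\frac{-x}{(1-x)(1-y)},\frac{-y}{(1-x)(1-y)}\right)^{*}$$ $$=\frac{1}{(q-1)^2}\sum_{\chi, \psi\in \widehat{\mathbb{F}_q^{\times}}}{_{2}F_1}\left(\begin{array}{cc}\overline{\chi}, & A\psi\\ & C'\end{array}\mid 1 \right)^{\ast}{_{2}F_1}\left(\begin{array}{cc}\overline{\psi}, & B\chi\\ & C\end{array}\mid 1 \right)^{\ast}\frac{g(A\psi)g(B\chi)g(\overline{\chi})g(\overline{\psi})}{g(A)g(B)}\,\psi(-x)\chi(-y).$$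
   Context: Let $p$ be an odd prime, $q=p^r$ with $r\ge 1$, and $\mathbb{F}_q$ the field with $q$ elements. $\widehat{\mathbb{F}_q^{\times}}$ is the group of multiplicative characters $\mathbb{F}_q^\times\to\mathbb{C}^\times$; every $\chi\in\widehat{\mathbb{F}_q^{\times}}$, including the trivial character $\varepsilon$, is extended to $\mathbb{F}_q$ by $\chi(0)=0$. $\overline{\chi}$ denotes the inverse character of $\chi$, and juxtaposition denotes the product of characters, an expression such as $\overline{A}B(t)$ meaning the product character $\overline{A}B$ evaluated at $t$; a bar over a product means the inverse of the product. Gauss sums: fix a primitive $p$-th root of unity $\zeta_p\in\mathbb{C}$, let $\theta(\alpha)=\zeta_p^{\mathrm{tr}(\alpha)}$ with $\mathrm{tr}:\mathbb{F}_q\to\mathbb{F}_p$ the trace, and set $g(\chi)=\sum_{t\in\mathbb{F}_q}\chi(t)\theta(t)$. For characters $A,B,C$ and $x\in\mathbb{F}_q$, McCarthy's function is $${_{2}F_1}\left(\begin{array}{cc}A, & B\\ & C\end{array}\mid x \right)^{\ast}=\frac{1}{q-1}\sum_{\chi\in \widehat{\mathbb{F}_q^{\times}}}\frac{g(A\chi)}{g(A)}\frac{g(B\chi)}{g(B)}\frac{g(\overline{C\chi})}{g(\overline{C})}g(\overline{\chi})\chi(x).$$ For characters $A,B,C,C'$ and $x,y\in\mathbb{F}_q$, $$F_{4}(A;B;C,C';x,y)^{*}=\frac{1}{(q-1)^2}\sum_{\psi,\chi\in\widehat{\mathbb{F}_q^{\times}}}\frac{g(A\chi\psi)g(B\chi\psi)g(\overline{C\psi})g(\overline{C'\chi})g(\overline{\psi})g(\overline{\chi})}{g(A)g(B)g(\overline{C})g(\overline{C'})}\psi(x)\chi(y).$$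 *)

(* Defs.v *)
From HB Require Import structures.
From mathcomp Require Import all_boot all_order all_fingroup all_algebra all_solvable all_field.

Set Implicit Arguments.
Unset Strict Implicit.
Unset Printing Implicit Defensive.

Import GRing.Theory.

Local Open Scope ring_scope.

Section MulChar.

Variables (F : finFieldType) (K : numClosedFieldType).

Definition is_mulchar (f : {ffun {unit F} -> K}) : bool :=
  (f 1%g == 1) && [forall u, forall v, f (u * v)%g == f u * f v].

Record mulchar := MulChar {
  mulchar_fun : {ffun {unit F} -> K};
  mulcharP : is_mulchar mulchar_fun }.

HB.instance Definition _ := [isSub for mulchar_fun].
HB.instance Definition _ := [Choice of mulchar by <:].

Implicit Types A B : mulchar.

(* Every character is extended by 0 at 0, including the trivial one:
   [insub x : option {unit F}] is [None] exactly when x = 0. *)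
Definition mulchar_ext A (x : F) : K :=
  if (insub x : option {unit F}) is Some u then mulchar_fun A u else 0.

Lemma mulchar_fun1 A : mulchar_fun A 1%g = 1.
Proof. by have /andP[/eqP] := mulcharP A. Qed.

Lemma mulchar_funM A u v :
  mulchar_fun A (u * v)%g = mulchar_fun A u * mulchar_fun A v.
Proof. by have /andP[_ /forallP/(_ u)/forallP/(_ v)/eqP] := mulcharP A. Qed.

Lemma mulchar_funX A u n : mulchar_fun A (u ^+ n)%g = mulchar_fun A u ^+ n.
Proof.
by elim: n => [|n IHn]; rewrite ?mulchar_fun1 // expgS exprS mulchar_funM IHn.
Qed.

Lemma mulchar_fun_unity A u : mulchar_fun A u ^+ #|[set: {unit F}]| = 1.
Proof. by rewrite -mulchar_funX expg_cardG ?inE ?mulchar_fun1. Qed.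

Lemma mulchar_fun_neq0 A u : mulchar_fun A u != 0.
Proof.
apply/eqP=> A0; have := mulchar_funM A u u^-1%g.
by rewrite mulgV mulchar_fun1 A0 mul0r => /eqP; rewrite oner_eq0.
Qed.

(* [mulchar] is a finite type because the values of a character lie among the
   finitely many #|[set: {unit F}]|-th roots of unity of K. *)
Definition unity_roots : seq K :=
  sval (closed_field_poly_normal ('X^#|[set: {unit F}]| - 1 : {poly K})).

Lemma mem_unity_roots A u : mulchar_fun A u \in unity_roots.
Proof.
have n_gt0 : (0 < #|[set: {unit F}]|)%N by rewrite cardG_gt0.
rewrite /unity_roots; case: closed_field_poly_normal => s /= Ds.
have: root ('X^#|[set: {unit F}]| - 1) (mulchar_fun A u).
  by rewrite rootE !hornerE mulchar_fun_unity subrr.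
rewrite Ds rootZ ?root_prod_XsubC // lead_coef_eq0.
by rewrite -size_poly_eq0 size_XnsubC.
Qed.

Definition mulchar_encode A : {ffun {unit F} -> seq_sub unity_roots} :=
  [ffun u => SeqSub (mem_unity_roots A u)].

Definition mulchar_decode (g : {ffun {unit F} -> seq_sub unity_roots}) :
    option mulchar :=
  insub [ffun u => ssval (g u)].

Lemma mulchar_encodeK : pcancel mulchar_encode mulchar_decode.
Proof.
move=> A; rewrite /mulchar_decode.
have -> : [ffun u => ssval (mulchar_encode A u)] = val A.
  by apply/ffunP=> u; rewrite !ffunE.
by rewrite valK.
Qed.

HB.instance Definition _ := PCanIsCountable mulchar_encodeK.
HB.instance Definition _ := isFinite.Build mulchar (pcan_enumP mulchar_encodeK).

Fact mulchar_one_subproof : is_mulchar [ffun => 1].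
Proof.
rewrite /is_mulchar ffunE eqxx /=.
by apply/forallP=> u; apply/forallP=> v; rewrite !ffunE mulr1.
Qed.

Fact mulchar_mul_subproof A B :
  is_mulchar [ffun u => mulchar_fun A u * mulchar_fun B u].
Proof.
rewrite /is_mulchar ffunE !mulchar_fun1 mulr1 eqxx /=.
apply/forallP=> u; apply/forallP=> v.
by rewrite !ffunE !mulchar_funM mulrACA.
Qed.

Fact mulchar_inv_subproof A : is_mulchar [ffun u => (mulchar_fun A u)^-1].
Proof.
rewrite /is_mulchar ffunE mulchar_fun1 invr1 eqxx /=.
apply/forallP=> u; apply/forallP=> v.
by rewrite !ffunE mulchar_funM invfM.
Qed.

Lemma mulchar_inj A B : mulchar_fun A =1 mulchar_fun B -> A = B.
Proof. by move=> AB; apply: val_inj; apply/ffunP. Qed.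

Definition mulchar_one := MulChar mulchar_one_subproof.
Definition mulchar_mul A B := MulChar (mulchar_mul_subproof A B).
Definition mulchar_inv A := MulChar (mulchar_inv_subproof A).

Lemma mulchar_oneE u : mulchar_fun mulchar_one u = 1.
Proof. exact: ffunE. Qed.

Lemma mulchar_mulE A B u :
  mulchar_fun (mulchar_mul A B) u = mulchar_fun A u * mulchar_fun B u.
Proof. exact: ffunE. Qed.

Lemma mulchar_invE A u : mulchar_fun (mulchar_inv A) u = (mulchar_fun A u)^-1.
Proof. exact: ffunE. Qed.

Fact mulchar_mulA : associative mulchar_mul.
Proof.
by move=> A B D; apply: mulchar_inj=> u; rewrite !mulchar_mulE mulrA.
Qed.

Fact mulchar_mul1 : left_id mulchar_one mulchar_mul.
Proof.
by move=> A; apply: mulchar_inj=> u; rewrite mulchar_mulE mulchar_oneE mul1r.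
Qed.

Fact mulchar_mulV : left_inverse mulchar_one mulchar_inv mulchar_mul.
Proof.
move=> A; apply: mulchar_inj=> u.
by rewrite mulchar_mulE mulchar_invE mulchar_oneE mulVf ?mulchar_fun_neq0.
Qed.

HB.instance Definition _ := Finite_isGroup.Build mulchar
  mulchar_mulA mulchar_mul1 mulchar_mulV.

Lemma mulchar_ext0 A : mulchar_ext A 0 = 0.
Proof. by rewrite /mulchar_ext insubN // unitr0. Qed.

Lemma mulchar_ext_val A (u : {unit F}) : mulchar_ext A (val u) = mulchar_fun A u.
Proof. by rewrite /mulchar_ext valK. Qed.

Lemma mulchar_extMg A B x :
  mulchar_ext (A * B)%g x = mulchar_ext A x * mulchar_ext B x.
Proof.
by rewrite /mulchar_ext; case: insub => [u|]; rewrite ?mul0r // mulchar_mulE.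
Qed.

Lemma mulchar_extVg A x : mulchar_ext (A^-1)%g x = (mulchar_ext A x)^-1.
Proof.
by rewrite /mulchar_ext; case: insub => [u|]; rewrite ?invr0 // mulchar_invE.
Qed.

End MulChar.

Coercion mulchar_ext : mulchar >-> Funclass.

Section Trace.

Variables (p r : nat) (F : finFieldType).

Definition conj_sum (a : F) : F := \sum_(i < r) a ^+ (p ^ i).

(* The trace from F to its prime field, as an element of 'F_p; [trFpE] shows
   that the default value is never used when F has p ^ r elements. *)
Definition trFp (a : F) : 'F_p :=
  odflt 0 [pick n : 'F_p | (n : nat)%:R == conj_sum a].

Hypotheses (p_pr : prime p) (r_gt0 : (0 < r)%N) (cardF : #|F| = (p ^ r)%N).

Lemma card_pchar : p \in [pchar F].
Proof. exact: card_finPcharP cardF p_pr. Qed.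

Lemma conj_sum_fixed a : conj_sum a ^+ p = conj_sum a.
Proof.
rewrite -(pFrobenius_autE card_pchar) /conj_sum rmorph_sum /=.
under eq_bigr do rewrite pFrobenius_autE -exprM -expnSr.
case: r r_gt0 cardF => // s _ cF.
by rewrite big_ord_recr /= -cF expf_card big_ord_recl expn0 expr1 addrC.
Qed.

Lemma trFpE a : (trFp a : nat)%:R = conj_sum a.
Proof.
rewrite /trFp; case: pickP => [n /eqP // | no_n] /=.
have p_gt1 := prime_gt1 p_pr.
pose P : {poly F} := 'X^p - 'X.
have szP : size P = p.+1.
  by rewrite size_polyDl ?size_polyXn // size_polyN size_polyX.
pose s := conj_sum a :: [seq (n : nat)%:R | n : 'F_p].
have P_neq0 : P != 0 by rewrite -size_poly_eq0 szP.
have root_s : all (root P) s.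
  rewrite /= {1}/root !hornerE conj_sum_fixed subrr eqxx /=.
  apply/allP=> _ /imageP[n _ ->].
  by rewrite /root !hornerE -(pFrobenius_autE card_pchar) rmorph_nat subrr.
have natr_inj (m n : 'F_p) : (m <= n)%N -> m%:R = n%:R :> F -> m = n.
  move=> le_mn /esym/eqP; rewrite -subr_eq0 -natrB //.
  rewrite -(dvdn_pcharf card_pchar) => p_dvd.
  have ltnp : (n < p)%N by rewrite -[X in (_ < X)%N](Fp_cast p_pr) ltn_ord.
  apply/val_inj/eqP; rewrite eqn_leq le_mn /= -subn_eq0 -leqn0 leqNgt.
  apply/negP=> /dvdn_leq/(_ p_dvd).
  by rewrite leqNgt (leq_ltn_trans (leq_subr _ _) ltnp).
have uniq_s : uniq s.
  rewrite /=; apply/andP; split.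
    by apply/imageP=> -[n _ Dn]; have := no_n n; rewrite Dn eqxx.
  apply/injectiveP=> m n mn.
  have [le_mn|/ltnW le_nm] := leqP m n; first exact: natr_inj le_mn mn.
  exact: esym (natr_inj _ _ le_nm (esym mn)).
have := max_poly_roots P_neq0 root_s uniq_s.
by rewrite szP /= size_image card_Fp // ltnn.
Qed.

End Trace.

Section HypergeometricFunctions.

Variables (F : finFieldType) (K : numClosedFieldType).

Definition addchar (p r : nat) (zeta : K) (a : F) : K := zeta ^+ trFp p r a.

Definition gauss (theta : F -> K) (chi : mulchar F K) : K :=
  \sum_(t : F) chi t * theta t.

Definition hyp2F1 (theta : F -> K) (A B C : mulchar F K) (x : F) : K :=
  let g := gauss theta in
  (#|F|%:R - 1)^-1 *
    \sum_(chi : mulchar F K)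
      g (A * chi)%g / g A * (g (B * chi)%g / g B)
      * (g (C * chi)^-1%g / g C^-1%g) * g chi^-1%g * chi x.

Definition appellF4 (theta : F -> K) (A B C C' : mulchar F K) (x y : F) : K :=
  let g := gauss theta in
  ((#|F|%:R - 1) ^+ 2)^-1 *
    \sum_(psi : mulchar F K) \sum_(chi : mulchar F K)
      (g (A * chi * psi)%g * g (B * chi * psi)%g * g (C * psi)^-1%g
        * g (C' * chi)^-1%g * g psi^-1%g * g chi^-1%g)
      / (g A * g B * g C^-1%g * g C'^-1%g) * psi x * chi y.

End HypergeometricFunctions.

(* Main.v *)
Require Import Defs.
From mathcomp Require Import all_boot all_order all_fingroup all_algebra all_solvable all_field.
From mathcomp Require Import ring reals complex.

Import GRing.Theory Num.Theory.

Local Open Scope ring_scope.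

(** The identity is a comparison of coefficients.  Write g for the Gauss sum
    and N for q - 1, and multiply the first hyp2F1 on the right by
    g(chi^-1) g(A psi) and the second by g(psi^-1) g(B chi), the factors that
    clear the denominators varying with chi and psi.  Opening both as sums over characters lam and mu,
    the right-hand side becomes a sum over (lam, mu) of a weight depending only
    on lam, mu, C and C', times the product of the two one-variable sums

      N^-1 sum_chi g(chi^-1 lam) g(B mu chi) chi(-y),
      N^-1 sum_psi g(psi^-1 mu) g(A lam psi) psi(-x).

    Each is evaluated by the finite-field binomial theorem [gauss_binomial],

      sum_chi g(chi^-1) g(D chi) chi(-z) = N D^-1(1 - z) g(D)  for z <> 0, 1,

    the analogue of the expansion of (1 - z)^(-d).  It holds because the sum
    over chi selects the pairs (s, t) with s = - z t in the product of the two
    Gauss sums, and there theta(s) theta(t) = theta((1 - z) t).  After the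
    shifts chi -> lam chi and psi -> mu psi, the characters evaluated at 1 - x
    and 1 - y are A lam mu and B lam mu: the parts A and B give the prefactor
    of the left-hand side, and lam, mu combine with lam(-y), mu(-x) into the
    arguments of appellF4.  When x or y is 0 both sides vanish, as every
    character is 0 at 0.

    Two classical facts support this: the orthogonality relations
    ([sum_mulchar]), which need enough characters and hence the cyclicity of
    the multiplicative group; and the nonvanishing of Gauss sums
    ([gauss_neq0]), which needs theta to be a nontrivial additive character
    ([addchar_nontrivial]). *)

(** * Multiplicative characters and their orthogonality *)

Section CharacterValues.

Variables (F : finFieldType) (K : numClosedFieldType).
Implicit Types (A B : mulchar F K) (x y : F).

Lemma unit_repr x : x != 0 -> exists u : {unit F}, x = val u.
Proof. by rewrite -unitfE => x_unit; exists (FinRing.Unit x_unit). Qed.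

Lemma mulchar_ext1 A : A 1 = 1.
Proof. by rewrite -[1]/(val (1%g : {unit F})) mulchar_ext_val mulchar_fun1. Qed.

Lemma mulchar_extM A x y : A (x * y) = A x * A y.
Proof.
have [-> | /unit_repr[u ->]] := eqVneq x 0.
  by rewrite mul0r mulchar_ext0 mul0r.
have [-> | /unit_repr[v ->]] := eqVneq y 0.
  by rewrite mulr0 mulchar_ext0 mulr0.
by rewrite -FinRing.val_unitM !mulchar_ext_val mulchar_funM.
Qed.

Lemma mulchar_extV A x : A x^-1 = (A x)^-1.
Proof.
have [-> | /unit_repr[u ->]] := eqVneq x 0.
  by rewrite invr0 mulchar_ext0 invr0.
rewrite -FinRing.val_unitV !mulchar_ext_val; apply/esym/divr1_eq.
by rewrite -invfM -mulchar_funM mulgV mulchar_fun1 invr1.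
Qed.

Lemma mulchar_ext_neq0 A x : x != 0 -> A x != 0.
Proof. by case/unit_repr=> u ->; rewrite mulchar_ext_val mulchar_fun_neq0. Qed.

Lemma mulchar_ext_one x : (1%g : mulchar F K) x = (x != 0)%:R.
Proof.
have [-> | /unit_repr[u ->]] := eqVneq x 0; first exact: mulchar_ext0.
by rewrite mulchar_ext_val mulchar_oneE.
Qed.

Lemma mulchar_neq1 A : A != 1%g -> exists2 c, c != 0 & A c != 1.
Proof.
move=> A_neq1; have [/existsP[u Au] | /existsPn A1] := boolP [exists u, mulchar_fun A u != 1].
  exists (val u); last by rewrite mulchar_ext_val.
  by rewrite -unitfE; apply: valP.
case/eqP: A_neq1; apply: mulchar_inj=> u; rewrite mulchar_oneE.
exact/eqP/negPn/A1.
Qed.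

Lemma card_sub1_neq0 : #|F|%:R - 1 != 0 :> K.
Proof.
rewrite subr_eq0 pnatr_eq1 neq_ltn.
by rewrite (cardD1 0) (cardD1 1) !inE oner_eq0 orbT.
Qed.

Lemma mulchar_mulC A B : (A * B = B * A)%g.
Proof. by apply: mulchar_inj=> u; rewrite !mulchar_mulE mulrC. Qed.

Lemma sum_units : \sum_(x : F) (x != 0)%:R = #|F|%:R - 1 :> K.
Proof.
rewrite -sum1_card natr_sum (bigD1 0) //= [in RHS](bigD1 0) //= eqxx add0r.
rewrite mulr1n [RHS]addrAC subrr add0r.
by apply: eq_bigr => x ->.
Qed.

(** If A is nontrivial, translating the sum by some c with A c <> 1 multiplies
    it by A c, so it is 0. *)
Lemma sum_mulchar_ext A : \sum_x A x = (A == 1%g)%:R * (#|F|%:R - 1).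
Proof.
have [-> | /mulchar_neq1[c c_neq0 Ac]] := eqVneq A 1%g.
  by rewrite mul1r -sum_units; apply: eq_bigr => x _; rewrite mulchar_ext_one.
rewrite mul0r; apply/eqP.
have /eqP : \sum_x A x = A c * \sum_x A x.
  rewrite mulr_sumr (reindex_inj (mulfI c_neq0)).
  by apply: eq_bigr => x _; rewrite mulchar_extM.
by rewrite eq_sym -subr_eq0 -{2}[\sum_x A x]mul1r -mulrBl mulf_eq0 subr_eq0 (negPf Ac).
Qed.

(** In characteristic 0 the polynomial X^n - 1 is separable, so an
    algebraically closed field contains n distinct n-th roots of unity. *)
Lemma prim_root_exists n : (0 < n)%N -> exists z : K, n.-primitive_root z.
Proof.
move=> n_gt0; pose P : {poly K} := 'X^n - 1.
have [s Ds] := closed_field_poly_normal P.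
have P_monic : lead_coef P = 1 by apply/eqP; apply: monicXnsubC.
rewrite P_monic scale1r in Ds.
have sz_s : size s = n.
  by apply: succn_inj; rewrite -(size_prod_XsubC s id) -Ds size_XnsubC.
have /hasP[z _ z_prim] : has n.-primitive_root s.
  apply: has_prim_root; rewrite ?sz_s //.
    by apply/allP=> z; rewrite -root_prod_XsubC -Ds.
  rewrite -separable_prod_XsubC -Ds separable_Xn_sub_1 //.
  by rewrite pnatr_eq0 -lt0n.
by exists z.
Qed.

(** As the multiplicative group is cyclic, sending a generator w to a primitive
    root of unity of order #[w] defines a character that is injective on units,
    so one character separates every unit x <> 1 from 1. *)
Lemma mulchar_separates x : x != 0 -> x != 1 -> exists A, A x != 1.
Proof.
case/unit_repr=> u -> u_neq1.
have /cyclicP[w gen_w] := field_unit_group_cyclic [set: {unit F}].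
have [z z_prim] := prim_root_exists _ (order_gt0 w).
have w_pow v : exists k, v = (w ^+ k)%g.
  by apply/cycleP; rewrite -gen_w inE.
(* The bound on the exponents is one more than the order of w only to make
   [ord0] available; any exponent found is right modulo that order. *)
pose f v := z ^+ odflt ord0 [pick i : 'I_#[w]%g.+1 | (w ^+ i)%g == v].
have fE k : f (w ^+ k)%g = z ^+ k.
  rewrite /f; case: pickP => [i | no_i] /=.
    rewrite eq_expg_mod_order => /eqP i_k.
    by apply/eqP; rewrite (eq_prim_root_expr z_prim) i_k.
  have lt_k : (k %% #[w]%g < #[w]%g.+1)%N by rewrite ltnS ltnW ?ltn_mod ?order_gt0.
  by have := no_i (Ordinal lt_k); rewrite /= expg_mod_order eqxx.
have f_char : is_mulchar [ffun v => f v].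
  rewrite /is_mulchar ffunE -(expg0 w) fE eqxx /=.
  apply/forallP=> a; apply/forallP=> b; rewrite !ffunE.
  have [[i ->] [j ->]] := (w_pow a, w_pow b).
  by rewrite -expgD !fE exprD.
exists (MulChar f_char); rewrite mulchar_ext_val /= ffunE.
have [k Dk] := w_pow u; rewrite Dk fE.
rewrite -(expr0 z) (eq_prim_root_expr z_prim) -eq_expg_mod_order -Dk expg0.
by apply: contraNneq u_neq1 => ->.
Qed.

(** For x <> 1 this is the dual of [sum_mulchar_ext], multiplying by a character
    that separates x from 1.  The value at 1, which is the number of characters,
    then follows by summing over all x in two ways. *)
Lemma sum_mulchar x :
  \sum_(A : mulchar F K) A x = (x == 1)%:R * (#|F|%:R - 1).
Proof.
have neq1 y : y != 1 -> \sum_(A : mulchar F K) A y = 0.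
  move=> y_neq1; have [-> | y_neq0] := eqVneq y 0.
    by apply: big1 => A _; rewrite mulchar_ext0.
  have [B By] := mulchar_separates _ y_neq0 y_neq1.
  apply/eqP; set S := \sum_A _.
  have /eqP : S = B y * S.
    rewrite mulr_sumr /S (reindex_inj (mulgI B)).
    by apply: eq_bigr => A _; rewrite mulchar_extMg.
  by rewrite eq_sym -subr_eq0 -{2}[S]mul1r -mulrBl mulf_eq0 subr_eq0 (negPf By).
have [-> | x_neq1] := eqVneq x 1; last by rewrite mul0r neq1.
transitivity (\sum_(y : F) \sum_(A : mulchar F K) A y).
  by rewrite [RHS](bigD1 1) //= [X in _ + X]big1 ?addr0 // => y /neq1.
rewrite exchange_big /= (bigD1 1%g) //= [X in _ + X]big1 => [|A A_neq1].
  by rewrite sum_mulchar_ext eqxx addr0.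
by rewrite sum_mulchar_ext (negPf A_neq1) mul0r.
Qed.

End CharacterValues.

(** * Gauss sums and the binomial theorem *)

Section GaussSums.

Variables (F : finFieldType) (K : numClosedFieldType) (theta : F -> K).
Hypothesis thetaD : forall a b, theta (a + b) = theta a * theta b.
Implicit Types (A B C D chi psi : mulchar F K) (x y z : F).

Local Notation g := (gauss theta).
Local Notation N := (#|F|%:R - 1 : K).

Lemma gauss_twist A b : b != 0 -> \sum_t A t * theta (b * t) = (A b)^-1 * g A.
Proof.
move=> b_neq0; rewrite /gauss mulr_sumr [RHS](reindex_inj (mulfI b_neq0)).
by apply: eq_bigr => t _; rewrite mulchar_extM mulrA mulKf ?mulchar_ext_neq0.
Qed.

(** The Fourier coefficient of A at b <> 0 is A(b)^-1 g(A).  If g(A) were 0,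
    only the coefficient at b = 0 would be left, and Fourier inversion at 1
    would give q = sum_t A t; but that sum is 0 or q - 1.  Trivial and
    nontrivial A are thus treated together. *)
Lemma gauss_neq0 A : theta 0 = 1 -> (exists a, theta a != 1) -> g A != 0.
Proof.
move=> theta0 [a theta_a].
have sum_theta c : c != 0 -> \sum_b theta (c * b) = 0.
  move=> c_neq0; transitivity (\sum_b theta b).
    by rewrite [RHS](reindex_inj (mulfI c_neq0)).
  apply/eqP.
  have /eqP : \sum_b theta b = theta a * \sum_b theta b.
    rewrite mulr_sumr (reindex_inj (addrI a)).
    by apply: eq_bigr => b _; rewrite thetaD.
  by rewrite eq_sym -subr_eq0 -{2}[\sum_b _]mul1r -mulrBl mulf_eq0 subr_eq0 (negPf theta_a).
apply/eqP=> gA0.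
(* q times the Fourier inversion formula at 1, where A takes the value 1. *)
have : \sum_b theta (- b) * \sum_t A t * theta (b * t) = #|F|%:R.
  transitivity (\sum_t A t * \sum_b theta ((t - 1) * b)).
    under eq_bigr do rewrite mulr_sumr.
    rewrite exchange_big; apply: eq_bigr => t _; rewrite mulr_sumr.
    apply: eq_bigr => b _; rewrite mulrBl mul1r thetaD mulrCA; congr (_ * _).
    by rewrite mulrC (mulrC b).
  rewrite (bigD1 1) //= [X in _ + X]big1 => [|t t_neq1].
    rewrite mulchar_ext1 mul1r addr0 subrr -sum1_card natr_sum.
    by apply: eq_bigr => b _; rewrite mul0r theta0.
  by rewrite sum_theta ?mulr0 // subr_eq0.
rewrite (bigD1 0) //= [X in _ + X]big1 => [|b b_neq0]; last first.
  by rewrite gauss_twist // gA0 !mulr0.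
under eq_bigr do rewrite mul0r theta0 mulr1.
rewrite oppr0 theta0 mul1r addr0 sum_mulchar_ext; apply/eqP.
case: (A == 1%g); last by rewrite mul0r eq_sym pnatr_eq0 (cardD1 0).
by rewrite mul1r -subr_eq0 addrAC subrr add0r oppr_eq0 oner_eq0.
Qed.

(** The analogue of the binomial series of (1 - z)^(-d): after opening both
    Gauss sums, orthogonality over chi keeps only the pairs s = - z t, for which
    theta s * theta t = theta ((1 - z) t); what remains is the Gauss sum of D
    twisted by 1 - z.  The pairs with t = 0 contribute nothing since D 0 = 0,
    and z <> 0 makes s a unit whenever t is. *)
Lemma gauss_binomial D z : z != 0 -> z != 1 ->
  \sum_chi g chi^-1%g * g (D * chi)%g * chi (- z) = N * ((D (1 - z))^-1 * g D).
Proof.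
move=> z_neq0 z_neq1; rewrite -gauss_twist ?subr_eq0 1?eq_sym // mulr_sumr.
transitivity (\sum_s \sum_t theta s * (D t * theta t) *
    \sum_(chi : mulchar F K) chi (- z * t / s)).
  under eq_bigr do rewrite /gauss big_distrlr mulr_suml.
  rewrite exchange_big; apply: eq_bigr => s _.
  under eq_bigr do rewrite mulr_suml.
  rewrite exchange_big; apply: eq_bigr => t _; rewrite mulr_sumr.
  apply: eq_bigr => chi _.
  rewrite mulchar_extMg mulchar_extVg !mulchar_extM mulchar_extV /=; ring.
rewrite exchange_big; apply: eq_bigr => t _ /=.
have [-> | t_neq0] := eqVneq t 0.
  rewrite mulchar_ext0 !mul0r [RHS]mulr0; apply: big1 => s _.
  by rewrite mulr0 mul0r.
have zt_neq0 : - z * t != 0 by rewrite mulf_neq0 ?oppr_eq0.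
rewrite (bigD1 (- z * t)) //= [X in _ + X]big1 => [|s s_neq].
  rewrite sum_mulchar divff // eqxx mul1r addr0.
  by rewrite (_ : (1 - z) * t = - z * t + t) ?thetaD; ring.
rewrite sum_mulchar (_ : (_ == 1) = false) ?mul0r ?mulr0 //.
have [-> | s_neq0] := eqVneq s 0; first by rewrite invr0 mulr0 eq_sym oner_eq0.
by rewrite -{1}(divff s_neq0) (inj_eq (mulIf _)) ?invr_eq0 // eq_sym (negPf s_neq).
Qed.

(** The form in which [gauss_binomial] occurs when the two functions hyp2F1 are
    opened; replacing chi by A chi reduces it to the case of the character
    D A. *)
Lemma gauss_binomial_shift D A z : z != 0 -> z != 1 ->
  N^-1 * \sum_chi g (chi^-1 * A)%g * g (D * chi)%g * chi (- z)
  = A (- z) * (((D * A)%g (1 - z))^-1 * g (D * A)%g).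
Proof.
move=> z_neq0 z_neq1; rewrite (reindex_inj (mulgI A)) /=.
transitivity (N^-1 * (A (- z) *
    \sum_chi g chi^-1%g * g (D * A * chi)%g * chi (- z))).
  congr (_ * _); rewrite mulr_sumr; apply: eq_bigr => chi _.
  by rewrite invMg mulgKV mulgA mulchar_extMg; ring.
rewrite gauss_binomial //; field; rewrite card_sub1_neq0 andbT.
by rewrite mulchar_ext_neq0 // subr_eq0 eq_sym.
Qed.

(** The factors g A and g B, which depend on the outer summation variables in
    the main identity, have to disappear before the sums can be exchanged. *)
Lemma hyp2F1_at1 A B C : g A != 0 -> g B != 0 ->
  hyp2F1 theta A B C 1 * (g A * g B)
  = N^-1 * \sum_chi g (A * chi)%g * g (B * chi)%g * (g (C * chi)^-1%g / g C^-1%g * g chi^-1%g).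
Proof.
move=> gA gB; rewrite /hyp2F1 -mulrA; congr (_ * _).
rewrite mulr_suml; apply: eq_bigr => chi _; rewrite mulchar_ext1.
rewrite mulr1 -!mulrA; move: (g C^-1%g)^-1 => c; field.
by rewrite gA gB.
Qed.

(** The identity for any additive character theta without vanishing Gauss
    sums: the trace enters only through these two properties. *)
Lemma appellF4_hyp2F1_expansion (g_neq0 : forall A, g A != 0) A B C C' x y :
    x != 1 -> y != 1 ->
  A^-1%g (1 - x) * B^-1%g (1 - y) *
    appellF4 theta A B C C'
      (- x / ((1 - x) * (1 - y))) (- y / ((1 - x) * (1 - y)))
  = (N ^+ 2)^-1 *
    \sum_(chi : mulchar F K) \sum_(psi : mulchar F K)
      hyp2F1 theta chi^-1%g (A * psi)%g C' 1
      * hyp2F1 theta psi^-1%g (B * chi)%g C 1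
      * (g (A * psi)%g * g (B * chi)%g * g chi^-1%g * g psi^-1%g / (g A * g B))
      * psi (- x) * chi (- y).
Proof.
move=> x_neq1 y_neq1.
have [x0 | x_neq0] := eqVneq x 0.
  rewrite /appellF4 x0 !oppr0 mul0r [in RHS]big1 ?[in LHS]big1 ?mulr0 // => chi _;
    by apply: big1 => psi _; rewrite mulchar_ext0 ?mulr0 mul0r.
have [y0 | y_neq0] := eqVneq y 0.
  rewrite /appellF4 y0 !oppr0 mul0r [in RHS]big1 ?[in LHS]big1 ?mulr0 // => chi _;
    by apply: big1 => psi _; rewrite mulchar_ext0 mulr0.
(* W is the common weight; a and b are the summands of the two binomial sums.
   In appellF4, lam is the character evaluated at the second argument and mu
   the one evaluated at the first. *)
pose W lam C1 := g (C1 * lam)^-1%g / g C1^-1%g * g lam^-1%g.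
pose a chi lam mu := g (chi^-1 * lam)%g * g (B * mu * chi)%g * chi (- y).
pose b psi lam mu := g (psi^-1 * mu)%g * g (A * lam * psi)%g * psi (- x).
transitivity ((N ^+ 2)^-1 * \sum_lam \sum_mu
    W lam C' * W mu C / (g A * g B) *
    ((N^-1 * \sum_chi a chi lam mu) * (N^-1 * \sum_psi b psi lam mu))).
  rewrite /appellF4 mulrCA; congr (_ * _).
  rewrite exchange_big /= mulr_sumr; apply: eq_bigr => lam _.
  rewrite mulr_sumr; apply: eq_bigr => mu _.
  rewrite /a /b !gauss_binomial_shift // /W.
  rewrite !mulchar_extMg !mulchar_extVg !(mulchar_extM, mulchar_extV).
  have -> : (B * mu * lam = B * lam * mu)%g by rewrite -!mulgA (mulchar_mulC _ _ mu).
  by rewrite !invfM; ring.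
congr (_ * _).
pose S lam mu chi psi := N^-1 ^+ 2 * (W lam C' * W mu C / (g A * g B) *
   (a chi lam mu * b psi lam mu)).
transitivity (\sum_lam \sum_mu \sum_chi \sum_psi S lam mu chi psi).
  apply: eq_bigr => lam _; apply: eq_bigr => mu _.
  rewrite /S; move: (W lam C' * _ / _) => w.
  rewrite (mulrACA N^-1) -expr2 big_distrlr /= [LHS]mulrCA !mulr_sumr.
  by apply: eq_bigr => chi _; rewrite !mulr_sumr.
transitivity (\sum_chi \sum_psi \sum_lam \sum_mu S lam mu chi psi).
  rewrite pair_bigA [RHS]pair_bigA /=.
  under eq_bigr do rewrite pair_bigA /=.
  by rewrite exchange_big; apply: eq_bigr => k _; rewrite [RHS]pair_bigA.
apply: eq_bigr => chi _; apply: eq_bigr => psi _.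
transitivity (hyp2F1 theta chi^-1%g (A * psi)%g C' 1 * (g chi^-1%g * g (A * psi)%g) *
  (hyp2F1 theta psi^-1%g (B * chi)%g C 1 * (g psi^-1%g * g (B * chi)%g)) *
  (psi (- x) * chi (- y) / (g A * g B))); last by ring.
rewrite !hyp2F1_at1 //; set c := _ / (g A * g B).
rewrite (mulrACA N^-1) -expr2 big_distrlr /= -mulrA mulr_suml mulr_sumr.
apply: eq_bigr => lam _; rewrite mulr_suml mulr_sumr; apply: eq_bigr => mu _.
rewrite /S /a /b /W.
have -> : (A * lam * psi = A * psi * lam)%g by rewrite -!mulgA (mulchar_mulC _ _ lam).
have -> : (B * mu * chi = B * chi * mu)%g by rewrite -!mulgA (mulchar_mulC _ _ mu).
by rewrite /c; congr (_ * _); ring.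
Qed.

End GaussSums.

(** * The additive character attached to the trace *)

Section AdditiveCharacter.

Variables (p r : nat) (F : finFieldType) (K : numClosedFieldType) (zeta : K).
Hypotheses (p_pr : prime p) (r_gt0 : (0 < r)%N) (cardF : #|F| = (p ^ r)%N).
Hypothesis zeta_prim : p.-primitive_root zeta.

Let theta := addchar p r zeta : F -> K.

(** Both zeta ^+ n and the image of n in F are injective functions of the residue
    of n modulo p; this turns statements on theta into statements on the
    trace computed in F. *)
Lemma eq_zeta_expr m n : (zeta ^+ m == zeta ^+ n) = (m%:R == n%:R :> F).
Proof.
rewrite (eq_prim_root_expr zeta_prim).
wlog le_nm : m n / (n <= m)%N.
  by move=> IH; case/orP: (leq_total n m) => /IH // E; rewrite eq_sym E eq_sym.
rewrite eqn_mod_dvd // (dvdn_pcharf (card_pchar p_pr cardF)).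
by rewrite natrB // subr_eq0.
Qed.

Lemma conj_sumD (a b : F) : conj_sum p r (a + b) = conj_sum p r a + conj_sum p r b.
Proof.
rewrite /conj_sum -big_split; apply: eq_bigr => i _ /=.
by apply: exprDn_pchar; rewrite pnatX pnatE // (card_pchar p_pr cardF).
Qed.

Lemma addcharD (a b : F) : theta (a + b) = theta a * theta b.
Proof.
apply/eqP; rewrite /theta /addchar -exprD eq_zeta_expr natrD.
by rewrite !trFpE // conj_sumD.
Qed.

Lemma addchar0 : theta 0 = 1.
Proof.
apply/eqP; rewrite /theta /addchar -(expr0 zeta) eq_zeta_expr trFpE //.
apply/eqP/big1 => i _; rewrite expr0n expn_eq0.
by case: (p) p_pr.
Qed.

(** If theta were trivial, every element of F would be a root of the trace
    polynomial, the sum of the X^(p^i) for i < r, which is nonzero of degree at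
    most p^(r-1) < q. *)
Lemma addchar_nontrivial : exists a, theta a != 1.
Proof.
apply/existsP; apply: contraT => /existsPn theta1.
pose P : {poly F} := \sum_(i < r) 'X^(p ^ i).
have p_gt1 := prime_gt1 p_pr.
have size_P : (size P <= (p ^ r.-1).+1)%N.
  apply: leq_trans (size_sum _ _ _) _; apply/bigmax_leqP=> i _.
  by rewrite size_polyXn ltnS leq_exp2l // -ltnS prednK.
have PE a : P.[a] = conj_sum p r a.
  by rewrite horner_sum; apply: eq_bigr => i _; rewrite hornerXn.
have P_neq0 : P != 0.
  apply/eqP=> /(congr1 (fun Q : {poly F} => Q`_1)).
  (* The linear coefficient of P is 1, coming from i = 0 alone. *)
  rewrite coef0 coef_sum (bigD1 (Ordinal r_gt0)) //= coefXn expn0 eqxx.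
  rewrite big1 ?addr0 => [|i i_neq0]; first by apply/eqP; rewrite oner_eq0.
  by rewrite coefXn -(expn0 p) eqn_exp2l // eq_sym [_ == _](negPf i_neq0).
have root_P : all (root P) (enum F).
  apply/allP=> a _; rewrite rootE PE -trFpE //.
  by rewrite -[0]/(0%:R) -eq_zeta_expr expr0; apply/negPn/theta1.
have := max_poly_roots P_neq0 root_P (enum_uniq F).
rewrite -cardE cardF ltnNge (leq_trans size_P) //.
by rewrite ltn_exp2l // ltn_predL.
Qed.

End AdditiveCharacter.

Theorem theorem1p1 (R : realType) (p r : nat) (F : finFieldType)
    (p_prime : prime p) (p_odd : odd p) (r_ge1 : (1 <= r)%N)
    (cardF : #|F| = (p ^ r)%N)
    (zeta : R[i]) (zeta_prim : p.-primitive_root zeta)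
    (A B C C' : mulchar F R[i]) (x y : F) (x_neq1 : x != 1) (y_neq1 : y != 1) :
  let theta := addchar p r zeta in
  let g := gauss theta in
  A^-1%g (1 - x) * B^-1%g (1 - y) *
    appellF4 theta A B C C'
      (- x / ((1 - x) * (1 - y))) (- y / ((1 - x) * (1 - y)))
  = ((#|F|%:R - 1) ^+ 2)^-1 *
    \sum_(chi : mulchar F R[i]) \sum_(psi : mulchar F R[i])
      hyp2F1 theta chi^-1%g (A * psi)%g C' 1
      * hyp2F1 theta psi^-1%g (B * chi)%g C 1
      * (g (A * psi)%g * g (B * chi)%g * g chi^-1%g * g psi^-1%g / (g A * g B))
      * psi (- x) * chi (- y).
Proof.
move=> theta g.
have thetaD := addcharD _ _ _ _ _ p_prime r_ge1 cardF zeta_prim.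
apply: appellF4_hyp2F1_expansion => // D; apply: gauss_neq0 => //.
  exact: addchar0.
exact: addchar_nontrivial.
Qed.
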